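(* Let $n=2$ and let $\hat\alpha=\bar X^2/S^2$ be the moment estimator of the shape parameter $\alpha$ based on a random sample $X_1,X_2$ from the gamma distribution with shape $\alpha>0$ and scale $\lambda>0$. Then $\hat\alpha$ is increasing in $\alpha$ with respect to the star order; that is, if $0<\alpha_1<\alpha_2$ and $\hat\alpha_i$ denotes the estimator based on a sample of size $2$ from the gamma distribution with shape $\alpha_i$ ($i=1,2$), then $\hat\alpha_1\leq_{*}\hat\alpha_2$.
   Context: The gamma distribution with shape $\alpha>0$ and scale $\lambda>0$ has density $f(x;\alpha,\lambda)=\frac{1}{\Gamma(\alpha)\lambda^{\alpha}}x^{\alpha-1}e^{-x/\lambda}$, $x>0$. A random sample is a collection of independent identically distributed random variables. For a sample $X_1,\dots,X_n$, $\bar X=\frac1n\sum_{i=1}^n X_i$ is the sample mean and $S^2=\frac1n\sum_{i=1}^n (X_i-\bar X)^2$ is the biased sample variance. For positive random variables $X,Y$ with continuous distribution functions $F,G$ strictly increasing on their (interval) supports, $X\leq_{*}Y$ (star order) means that $G^{-1}(F(x))/x$ is nondecreasing in $x>0$ on the support of $X$; equivalently, $G^{-1}(u)/F^{-1}(u)$ is nondecreasing in $u\in(0,1)$. *)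

(* Defs.v *)
From HB Require Import structures.
From mathcomp Require Import all_boot all_order all_algebra.
From mathcomp Require Import all_classical all_reals all_analysis.
From mathcomp Require Import measurable_realfun.

Set Implicit Arguments.
Unset Strict Implicit.
Unset Printing Implicit Defensive.

Import Order.TTheory GRing.Theory Num.Theory.
Import numFieldNormedType.Exports.

Local Open Scope classical_set_scope.
Local Open Scope ring_scope.

Section gamma_distribution.
Context {R : realType}.

Definition gamma_fun (a : R) : R :=
  \int[lebesgue_measure]_(x in `]0, +oo[) (x `^ (a - 1) * expR (- x)).

Definition gamma_pdf (a l x : R) : R :=
  if 0 < x then (gamma_fun a * l `^ a)^-1 * x `^ (a - 1) * expR (- x / l)
  else 0.

Definition has_gamma_law d (T : measurableType d) (P : probability T R)
    (X : {RV P >-> R}) (a l : R) : Prop :=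
  forall A : set R, measurable A ->
    distribution P X A = (\int[lebesgue_measure]_(x in A) (gamma_pdf a l x)%:E)%E.

End gamma_distribution.

Section random_sample.
Context {R : realType} d (T : measurableType d) (P : probability T R) (n : nat).
Implicit Type X : 'I_n -> {RV P >-> R}.

(* The product rule for a proper subfamily is the case where the remaining
   A i are [set: R]. *)
Definition independent_RVs X : Prop :=
  forall A : 'I_n -> set R, (forall i, measurable (A i)) ->
    P (\bigcap_(i in [set: 'I_n]) (X i @^-1` A i))
    = (\prod_(i < n) P (X i @^-1` A i))%E.

Definition identically_distributed X : Prop :=
  forall (i j : 'I_n) (A : set R), measurable A ->
    distribution P (X i) A = distribution P (X j) A.

Definition random_sample X : Prop :=
  independent_RVs X /\ identically_distributed X.

Definition gamma_sample X (a l : R) : Prop :=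
  random_sample X /\ forall i, has_gamma_law (X i) a l.

Definition sample_mean X (w : T) : R := n%:R^-1 * \sum_(i < n) X i w.

(* Biased version: the normalisation is 1/n. *)
Definition sample_var X (w : T) : R :=
  n%:R^-1 * \sum_(i < n) (X i w - sample_mean X w) ^+ 2.

(* Where the sample variance vanishes this is 0, because x / 0 = 0. *)
Definition moment_shape X (w : T) : R :=
  sample_mean X w ^+ 2 / sample_var X w.

End random_sample.

Lemma measurable_inv_real (R : realType) :
  measurable_fun [set: R] (fun x : R => x^-1).
Proof.
have m0 : measurable [set 0 : R] by exact: measurable_set1.
have -> : [set: R] = [set 0] `|` ~` [set 0] by rewrite setUv.
apply/measurable_funU => //; first exact: measurableC.
split; first exact: measurable_fun_set1.
apply: open_continuous_measurable_fun.
  by apply: closed_openC; exact: closed_eq.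
by move=> x /set_mem/= /eqP x0; exact: inv_continuous.
Qed.

Section moment_shape_measurable.
Context {R : realType} d (T : measurableType d) (P : probability T R) (n : nat).
Variable X : 'I_n -> {RV P >-> R}.

Lemma measurable_sample_mean : measurable_fun [set: T] (sample_mean X).
Proof. by apply: measurable_funM => //; apply: measurable_sum. Qed.

Lemma measurable_sample_var : measurable_fun [set: T] (sample_var X).
Proof.
apply: measurable_funM => //; apply: measurable_sum => i.
apply: measurable_funX; apply: measurable_funB => //.
exact: measurable_sample_mean.
Qed.

Lemma measurable_moment_shape : measurable_fun [set: T] (moment_shape X).
Proof.
apply: measurable_funM.
  by apply: measurable_funX; exact: measurable_sample_mean.
exact: measurableT_comp (@measurable_inv_real R) measurable_sample_var.
Qed.

HB.instance Definition _ :=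
  isMeasurableFun.Build _ _ _ _ (moment_shape X) measurable_moment_shape.

Definition moment_shape_RV : {RV P >-> R} := moment_shape X.

End moment_shape_measurable.

Section star_order.
Context {R : realType}.

(* Topological support of the law of X. *)
Definition law_support d (T : measurableType d) (P : probability T R)
    (X : {RV P >-> R}) : set R :=
  [set x | forall e : R, 0 < e -> (0 < P (X @^-1` ball x e))%E].

(* Random variables between which the star order is considered. *)
Definition star_regular d (T : measurableType d) (P : probability T R)
    (X : {RV P >-> R}) : Prop :=
  [/\ {ae P, forall w, 0 < X w},
      continuous (cdf X),
      is_interval (law_support X) &
      forall x y, law_support X x -> law_support X y -> x < y ->
        (cdf X x < cdf X y)%E].

(* Inverse of the distribution function restricted to the support. At u = 0 it
   is the left endpoint of the support; at u = 1 it is the right endpoint,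
   +oo if the support is unbounded. *)
Definition cdf_inv d (T : measurableType d) (P : probability T R)
    (X : {RV P >-> R}) (u : \bar R) : \bar R :=
  ereal_inf (EFin @` [set x | law_support X x /\ (u <= cdf X x)%E]).

Definition star_le d1 (T1 : measurableType d1) (P1 : probability T1 R)
    d2 (T2 : measurableType d2) (P2 : probability T2 R)
    (X : {RV P1 >-> R}) (Y : {RV P2 >-> R}) : Prop :=
  [/\ star_regular X, star_regular Y &
      forall x y : R, law_support X x -> law_support X y -> 0 < x -> x <= y ->
        (cdf_inv Y (cdf X x) * (x^-1)%:E <= cdf_inv Y (cdf X y) * (y^-1)%:E)%E].

End star_order.

(* Main.v *)
(* Write W = |X1 - X2| / (X1 + X2), so that the moment estimator is W^-2. The
   ratio X1 / X2 has a density proportional to z^(a-1) (1+z)^(-2a), hence the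
   distribution function M of W satisfies M'(t) = C (1 - t^2)^(a-1) on (0, 1).
   Inversion and squaring reduce the star order between the estimators to the
   monotonicity of s(t) / t, where M2 (s(t)) = M1 t. If s(t) / t failed to be
   nondecreasing, then for a suitable 0 < k < 1 the function M1 x - M2 (k x) would
   be, at successive points of [0, 1], zero, positive, negative and positive, so
   its derivative would be positive, then negative, then positive. This is
   impossible because (1 - u)^(a1-1) / (1 - k^2 u)^(a2-1) is quasiconcave in u. *)
Require Import Defs.
From HB Require Import structures.
From mathcomp Require Import all_boot all_order all_algebra.
From mathcomp Require Import all_classical all_reals all_analysis.
From mathcomp Require Import measurable_realfun ring lra.

Set Implicit Arguments.
Unset Strict Implicit.
Unset Printing Implicit Defensive.

Import Order.TTheory GRing.Theory Num.Theory.
Import numFieldNormedType.Exports.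

Local Open Scope classical_set_scope.
Local Open Scope ring_scope.

(** * Single crossing of the distribution functions *)

Section single_crossing.
Context {R : realType}.
Implicit Types (f df M : R -> R).

Lemma MVT_gt0 f df (a b : R) : a < b ->
  (forall x, x \in `]a, b[ -> is_derive x 1 f (df x)) ->
  {within `[a, b], continuous f} -> f a < f b ->
  exists2 c, c \in `]a, b[ & 0 < df c.
Proof.
move=> ab fd fc fab; have [c cab e] := MVT ab fd fc.
by exists c => //; rewrite -(@pmulr_lgt0 _ (b - a)) ?subr_gt0// -e subr_gt0.
Qed.

Lemma MVT_lt0 f df (a b : R) : a < b ->
  (forall x, x \in `]a, b[ -> is_derive x 1 f (df x)) ->
  {within `[a, b], continuous f} -> f b < f a ->
  exists2 c, c \in `]a, b[ & df c < 0.
Proof.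
move=> ab fd fc fab; have [c cab e] := MVT ab fd fc.
by exists c => //; rewrite -(@pmulr_llt0 _ (b - a)) ?subr_gt0// -e subr_lt0.
Qed.

(* Distribution function of |2 B - 1| for B with law Beta(a, a). *)
Definition semicircular_cdf (a : R) M := [/\ continuous M, M 0 = 0, M 1 = 1 &
  exists2 C : R, 0 < C &
    forall t : R, 0 < t < 1 -> is_derive t 1 M (C * (1 - t ^+ 2) `^ (a - 1))].

Lemma semicircular_cdf_lt a M : semicircular_cdf a M ->
  {in `[0, 1] &, {homo M : x y / x < y}}.
Proof.
move=> [Mc _ _ [C C0 dM]]; apply: gtr0_derive1_lt_cc.
- by move=> x; rewrite in_itv/= => /dM[].
- move=> x; rewrite in_itv/= => /[dup] x01 /dM dMx.
  rewrite derive1E derive_val mulr_gt0// powR_gt0//.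
  case/andP: x01; nra.
- exact: continuous_subspaceT.
Qed.

(** The derivative of [M1 - M2] is a positive factor times C1 - C2 (1 - x^2)^(a2 - a1), and this
    bracket is nondecreasing in x on (0, 1). A positive value of [M1 - M2] at [t] would force the
    bracket to be positive before [t] and negative after it, since the difference vanishes at 0 and
    1. *)
Lemma semicircular_cdf_le a1 a2 M1 M2 : a1 < a2 ->
  semicircular_cdf a1 M1 -> semicircular_cdf a2 M2 ->
  forall t : R, 0 <= t <= 1 -> M1 t <= M2 t.
Proof.
move=> a12 [Mc1 M10 M11 [C1 C10 dM1]] [Mc2 M20 M21 [C2 C20 dM2]] t.
rewrite 2!le_eqVlt => /andP[/predU1P[<-|t0]]; first by rewrite M10 M20.
move=> /predU1P[->|t1]; first by rewrite M11 M21.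
rewrite leNgt; apply/negP => M21t.
pose D x := M1 x - M2 x.
pose dD (x : R) :=
  C1 * (1 - x ^+ 2) `^ (a1 - 1) - C2 * (1 - x ^+ 2) `^ (a2 - 1).
have DdD (x : R) : 0 < x < 1 -> is_derive x 1 D (dD x).
  by move=> x01; apply: is_deriveB; [exact: dM1|exact: dM2].
have Di (a b : R) : 0 <= a -> b <= 1 ->
    forall x, x \in `]a, b[ -> is_derive x 1 D (dD x).
  by move=> a0 b1 x; rewrite in_itv/= => /andP[? ?]; apply: DdD; lra.
have Dc A : {within A, continuous D}.
  by apply: continuous_subspaceT => x; apply: cvgB; [exact: Mc1|exact: Mc2].
have [|x1 + H1] := MVT_gt0 t0 (Di _ _ (lexx 0) (ltW t1)) (Dc _).
  by rewrite /D M10 M20; lra.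
have [|x2 + H2] := MVT_lt0 t1 (Di _ _ (ltW t0) (lexx 1)) (Dc _).
  by rewrite /D M11 M21; lra.
rewrite !in_itv/= => /andP[tx2 x21] /andP[x10 x1t].
have p1 : 0 < 1 - x1 ^+ 2 by nra.
have p2 : 0 < 1 - x2 ^+ 2 by nra.
have E (x : R) : 0 < 1 - x ^+ 2 -> (1 - x ^+ 2) `^ (a2 - 1) =
    (1 - x ^+ 2) `^ (a1 - 1) * (1 - x ^+ 2) `^ (a2 - a1).
  move=> x0; rewrite -powRD; last by rewrite (gt_eqF x0) implybT.
  by congr powR; ring.
have : (1 - x2 ^+ 2) `^ (a2 - a1) <= (1 - x1 ^+ 2) `^ (a2 - a1).
  by apply: ge0_ler_powR; rewrite ?nnegrE; nra.
have P1 : 0 < (1 - x1 ^+ 2) `^ (a1 - 1) by exact: powR_gt0.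
have P2 : 0 < (1 - x2 ^+ 2) `^ (a1 - 1) by exact: powR_gt0.
rewrite /dD (E _ p1) in H1; rewrite /dD (E _ p2) in H2.
move: H1 H2 P1 P2.
set p1' := _ `^ (a1 - 1); set p2' := _ `^ (a1 - 1).
set q1 := _ `^ _; set q2 := _ `^ _ => H1 H2 P1 P2 q12.
have : 0 < C1 - C2 * q1 by rewrite -(pmulr_rgt0 _ P1); lra.
have : C1 - C2 * q2 < 0 by rewrite -(pmulr_rlt0 _ P2); lra.
have : C2 * q2 <= C2 * q1 by rewrite ler_pM2l.
lra.
Qed.

(* The derivative of [u |-> ln ((1 - u)^b1 / (1 - k2 u)^b2)] has the sign of a
   decreasing affine function of [u]. *)
Lemma powR_ratio_quasiconcave (c1 c2 b1 b2 k2 u1 u2 u3 : R) :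
  0 < c1 -> 0 < c2 -> b1 < b2 -> 0 < k2 -> k2 < 1 ->
  0 < u1 -> u1 < u2 -> u2 < u3 -> u3 < 1 ->
  c2 * (1 - k2 * u1) `^ b2 < c1 * (1 - u1) `^ b1 ->
  c1 * (1 - u2) `^ b1 < c2 * (1 - k2 * u2) `^ b2 ->
  c2 * (1 - k2 * u3) `^ b2 < c1 * (1 - u3) `^ b1 -> False.
Proof.
move=> c10 c20 b12 k0 k1 u10 u12 u23 u31.
have pos1 (u : R) : 0 < u -> u < 1 -> 0 < 1 - u by lra.
have pos2 (u : R) : 0 < u -> u < 1 -> 0 < 1 - k2 * u by nra.
have lnE (c x b : R) : 0 < c -> 0 < x -> ln (c * x `^ b) = ln c + b * ln x.
  by move=> c0 x0; rewrite lnM ?posrE ?powR_gt0// ln_powR.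
have ltE (u : R) : 0 < u -> u < 1 ->
  (c2 * (1 - k2 * u) `^ b2 < c1 * (1 - u) `^ b1) =
  (ln c2 + b2 * ln (1 - k2 * u) < ln c1 + b1 * ln (1 - u)).
  move=> u0 u1'; have p1 := pos1 _ u0 u1'; have p2 := pos2 _ u0 u1'.
  by rewrite -(lnE c2)// -(lnE c1)// ltr_ln// posrE mulr_gt0// powR_gt0.
have gtE (u : R) : 0 < u -> u < 1 ->
  (c1 * (1 - u) `^ b1 < c2 * (1 - k2 * u) `^ b2) =
  (ln c1 + b1 * ln (1 - u) < ln c2 + b2 * ln (1 - k2 * u)).
  move=> u0 u1'; have p1 := pos1 _ u0 u1'; have p2 := pos2 _ u0 u1'.
  by rewrite -(lnE c2)// -(lnE c1)// ltr_ln// posrE mulr_gt0// powR_gt0.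
rewrite !ltE ?gtE; try lra.
move=> H1 H2 H3.
(* The three inequalities put [L] above, below and again above the level ln c2 - ln c1, so its
   derivative is negative somewhere in ]u1, u2[ and positive somewhere in ]u2, u3[. *)
pose L (u : R) := b1 * ln (1 - u) - b2 * ln (1 - k2 * u).
pose dL (u : R) := b1 * ((1 - u)^-1 * -1) - b2 * ((1 - k2 * u)^-1 * - k2).
have dLE (u : R) : 0 < u -> u < 1 -> is_derive u 1 L (dL u).
  move=> u0 u1'.
  have d1 : is_derive u 1 (fun u : R => 1 - u) (-1).
    by apply: is_derive_eq; ring.
  have d2 : is_derive u 1 (fun u : R => 1 - k2 * u) (- k2).
    by apply: is_derive_eq; rewrite /GRing.scale/=; ring.
  have e1 := @is_derive1_comp _ _ (fun u : R => 1 - u) _ _ _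
    (is_derive1_ln (pos1 _ u0 u1')) d1.
  have e2 := @is_derive1_comp _ _ (fun u : R => 1 - k2 * u) _ _ _
    (is_derive1_ln (pos2 _ u0 u1')) d2.
  exact: is_deriveB (is_deriveZ b1 e1) (is_deriveZ b2 e2).
have Li (a b : R) : 0 < a -> b < 1 ->
    forall x, x \in `]a, b[ -> is_derive x 1 L (dL x).
  by move=> a0 b1' x; rewrite in_itv/= => /andP[? ?]; apply: dLE; lra.
have Lc (a b : R) : 0 < a -> b < 1 -> {within `[a, b], continuous L}.
  move=> a0 b1'; apply: derivable_within_continuous => x.
  by rewrite in_itv/= => /andP[? ?]; have [] // := dLE x; lra.
have [|v1 + Hv1] := MVT_lt0 u12
    (Li _ _ u10 (lt_trans u23 u31)) (Lc _ _ u10 (lt_trans u23 u31)).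
  by rewrite /L; lra.
have [|v2 + Hv2] := MVT_gt0 u23
    (Li _ _ (lt_trans u10 u12) u31) (Lc _ _ (lt_trans u10 u12) u31).
  by rewrite /L; lra.
rewrite !in_itv/= => /andP[a1 a2] /andP[a3 a4].
have dLN (v : R) : 0 < v -> v < 1 -> dL v * ((1 - v) * (1 - k2 * v)) =
    b2 * k2 * (1 - v) - b1 * (1 - k2 * v).
  move=> v0 v1'; have p1 := pos1 _ v0 v1'; have p2 := pos2 _ v0 v1'.
  by rewrite /dL; field; rewrite (gt_eqF p1) (gt_eqF p2).
have P1 : 0 < (1 - v1) * (1 - k2 * v1) 
  by apply: mulr_gt0; [apply: pos1|apply: pos2]; lra.
have P2 : 0 < (1 - v2) * (1 - k2 * v2) 
  by apply: mulr_gt0; [apply: pos1|apply: pos2]; lra.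
have : dL v1 * ((1 - v1) * (1 - k2 * v1)) < 0 by rewrite pmulr_llt0.
have : 0 < dL v2 * ((1 - v2) * (1 - k2 * v2)) by rewrite pmulr_lgt0.
rewrite !dLN; try lra.
move=> h2 h1.
(* This product is the amount by which the affine numerator of [dL] drops from [v1] to [v2]; a
   numerator negative at [v1] cannot be positive at [v2]. *)
have : 0 < k2 * ((b2 - b1) * (v2 - v1)) by do 2?apply: mulr_gt0; lra.
lra.
Qed.

Lemma semicircular_cdf_ratio a1 a2 M1 M2 : a1 < a2 ->
  semicircular_cdf a1 M1 -> semicircular_cdf a2 M2 ->
  forall t t' s s' : R, 0 < t -> t < t' -> t' <= 1 -> 0 < s <= 1 -> 0 < s' <= 1 ->
  M2 s = M1 t -> M2 s' = M1 t' -> s / t <= s' / t'.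
Proof.
move=> a12 M1P M2P t t' s s' t0 tt' t'1 /andP[s0 s1] /andP[s'0 s'1] st st'.
have M2lt := semicircular_cdf_lt M2P.
(* Hence [s / t] is at most 1, which will keep the scaling factor [k] below 1. *)
have s_le_t : s <= t.
  rewrite leNgt; apply/negP => ts; have : M2 t < M2 s.
    by apply: M2lt => //; rewrite in_itv/=; lra.
  by rewrite st ltNge (semicircular_cdf_le a12)//; lra.
case: M1P M2P => [Mc1 M10 M11 [C1 C10 dM1]] [Mc2 M20 M21 [C2 C20 dM2]].
rewrite leNgt; apply/negP => st_lt.
(* The midpoint lies strictly between the two ratios, so that k t < s and s' < k t'; these
   inequalities fix the signs of [D] at [t] and [t']. *)
pose k := (s / t + s' / t') / 2.
have kst : k < s / t by rewrite /k; lra.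
have kst' : s' / t' < k by rewrite /k; lra.
have k0 : 0 < k by apply: lt_trans kst'; rewrite divr_gt0//; lra.
have k1 : k < 1 by apply: (lt_le_trans kst); rewrite ler_pdivrMr// mul1r.
have kt : k * t < s by rewrite -ltr_pdivlMr.
have kt' : s' < k * t' by rewrite -ltr_pdivrMr//; lra.
pose D x := M1 x - M2 (k * x).
pose dD (x : R) :=
  C1 * (1 - x ^+ 2) `^ (a1 - 1) - C2 * (1 - (k * x) ^+ 2) `^ (a2 - 1) * k.
have DdD (x : R) : 0 < x < 1 -> is_derive x 1 D (dD x).
  move=> /andP[x0 x1]; apply: is_deriveB; first by apply: dM1; lra.
  apply: (@is_derive1_comp _ M2 ( *%R k)); first by apply: dM2; nra.
  by apply: is_derive_eq; rewrite /GRing.scale/= mulr1.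
have Di (a b : R) : 0 <= a -> b <= 1 ->
    forall x, x \in `]a, b[ -> is_derive x 1 D (dD x).
  by move=> a0 b1 x; rewrite in_itv/= => /andP[? ?]; apply: DdD; lra.
have Dc A : {within A, continuous D}.
  apply: continuous_subspaceT => x; apply: cvgB; first exact: Mc1.
  by apply: (@continuous_comp _ _ _ ( *%R k)); [exact: mulrl_continuous|exact: Mc2].
have Dt : 0 < D t.
  by rewrite /D -st subr_gt0; apply: M2lt => //; rewrite in_itv/=; nra.
have Dt' : D t' < 0.
  by rewrite /D -st' subr_lt0; apply: M2lt => //; rewrite in_itv/=; nra.
have D0 : D 0 = 0 by rewrite /D mulr0 M10 M20 subrr.
have D1 : 0 < D 1.
  by rewrite /D mulr1 M11 -M21 subr_gt0; apply: M2lt; rewrite ?in_itv/=; lra.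
(* [D] is negative at [t'] and positive at 1, so the third interval [t', 1] is not degenerate. *)
have {}t'1 : t' < 1.
  by rewrite lt_neqAle t'1 andbT; apply: contraTN Dt' => /eqP ->; rewrite -leNgt ltW.
have [|x1 + H1] := MVT_gt0 t0 (Di _ _ (lexx 0) (ltW (lt_trans tt' t'1))) (Dc _).
  by rewrite D0.
have [|x2 + H2] := MVT_lt0 tt' (Di _ _ (ltW t0) (ltW t'1)) (Dc _).
  exact: lt_trans Dt.
have [|x3 + H3] := MVT_gt0 t'1 (Di _ _ (ltW (lt_trans t0 tt')) (lexx 1)) (Dc _).
  exact: lt_trans D1.
rewrite !in_itv/= => /andP[? ?] /andP[? ?] /andP[? ?].
(* The variable is u = x^2, and the factor [k] produced by the chain rule is absorbed into the
   second constant. *)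
apply: (@powR_ratio_quasiconcave C1 (C2 * k) (a1 - 1) (a2 - 1) (k ^+ 2)
  (x1 ^+ 2) (x2 ^+ 2) (x3 ^+ 2)); rewrite -?exprMn; try by nra.
all: by rewrite mulrAC; move: H1 H2 H3; rewrite /dD; lra.
Qed.

End single_crossing.

(** * The inverse square of a random variable *)

Section cdf_no_atom.
Context {R : realType} d (T : measurableType d) (P : probability T R).
Variable X : {RV P >-> R}.
Hypothesis X_atom : forall r : R, P (X @^-1` [set r]) = 0%E.

(** Right continuity holds for every distribution function. Without atoms, the distribution function
    of X at r is 1 minus that of -X at -r, so right continuity for -X gives left continuity for
    X. *)
Lemma cdf_no_atom_continuous : continuous (cdf X).
Proof.
have mN : measurable_fun [set: T] (fun w => - X w) by exact: measurable_funN.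
pose Y : {RV P >-> R} := HB.pack_for {mfun T >-> R} (fun w => - X w)
  (isMeasurableFun.Build _ _ _ _ _ mN).
have XE r : cdf X r = (1 - cdf Y (- r))%E.
  have mY : measurable (Y @^-1` `]-oo, - r]) by exact: measurable_funPTI.
  rewrite /cdf /distribution /pushforward -probability_setC//.
  rewrite -(@measureU0 _ _ _ P (~` _) (X @^-1` [set r]) (measurableC mY))//.
  congr (P _); apply/seteqP; split => w /=; rewrite !in_itv/= lerN2.
    rewrite le_eqVlt => /predU1P[|Xr]; first by right.
    by left; apply/negP; rewrite -ltNge.
  by move=> [/negP|->//]; rewrite -ltNge => /ltW.
  exact: X_atom.
move=> a; apply/left_right_continuousP; split; last exact: cdf_right_continuous.
apply/cvg_at_leftNP; rewrite [X in _ --> X]XE.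
rewrite (_ : _ \o _ = fun s => (1 - cdf Y s)%E); last first.
  by apply/funext => s /=; rewrite XE opprK.
by apply: cvgeB => //; [exact: cvg_cst|exact: cdf_right_continuous].
Qed.

End cdf_no_atom.

Lemma invsqrt_itv (R : realType) (x : R) : 1 <= x -> 0 < (Num.sqrt x)^-1 <= 1.
Proof.
move=> x1; have sx1 : 1 <= Num.sqrt x by rewrite -[leLHS]sqrtr1 ler_sqrt//; lra.
by rewrite invr_gt0 invf_le1 ?sx1 ?andbT//; lra.
Qed.

Section inverse_square.
Context {R : realType} d (T : measurableType d) (P : probability T R).
Variables (X W : {RV P >-> R}) (a : R).
Hypothesis XW : forall w, X w = (W w ^+ 2)^-1.
Hypothesis W_atom : forall r : R, P (W @^-1` [set r]) = 0%E.
Hypothesis W_cdf : semicircular_cdf a (fine \o cdf W).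
Let M := fine \o cdf W.

Let mpre (Y : {RV P >-> R}) (A : set R) : measurable A -> measurable (Y @^-1` A).
Proof. by move=> mA; exact: measurable_funPTI. Qed.

Let cdfWE r : cdf W r = (M r)%:E.
Proof. by rewrite /M/= fineK// fin_num_measure. Qed.

Let W_le0 : P (W @^-1` `]-oo, 0]) = 0%E.
Proof. by have [_ M0 _ _] := W_cdf; have := cdfWE 0; rewrite /M M0. Qed.

Lemma inverse_square_cdf x : 0 < x -> cdf X x = (1 - M (Num.sqrt x)^-1)%:E.
Proof.
move=> x0; have sx0 : 0 < Num.sqrt x by rewrite sqrtr_gt0.
have mX : measurable (X @^-1` `]-oo, x]) by exact: mpre.
rewrite EFinB -cdfWE /cdf /distribution /pushforward.
rewrite -[X @^-1` _]setCK probability_setC; last exact: measurableC.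
congr (_ - _)%E.
have mW0 : measurable (W @^-1` `]-oo, 0]) by exact: mpre.
have mXW : measurable (~` (X @^-1` `]-oo, x]) `|` W @^-1` `]-oo, 0]).
  by apply: measurableU => //; exact: measurableC.
have mWx : measurable (W @^-1` [set (Num.sqrt x)^-1]) by exact: mpre.
(* Up to two null events, X > x is the event W <= 1 / sqrt x: the comparison of squares needs W > 0,
   and the strict inequality misses the value 1 / sqrt x. *)
rewrite -(measureU0 (measurableC mX) mW0 W_le0) -(measureU0 mXW mWx (W_atom _)).
congr (P _); apply/seteqP; split => w /=; rewrite !in_itv/= XW.
  have x2 : (Num.sqrt x)^-1 ^+ 2 = x^-1 by rewrite exprVn sqr_sqrtr// ltW.
  move=> [[/negP|W0]|->//]; last by rewrite (le_trans W0)// invr_ge0 ltW.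
  rewrite -ltNge; case: (leP (W w) 0) => W0.
    by rewrite (le_trans W0)// invr_ge0 ltW.
  rewrite -{1}(invrK x) ltf_pV2 ?posrE ?invr_gt0 ?exprn_gt0// -x2 ltr_pXn2r//.
  - exact: ltW.
  - by rewrite nnegrE ltW.
  - by rewrite nnegrE invr_ge0 ltW.
have x2 : (Num.sqrt x)^-1 ^+ 2 = x^-1 by rewrite exprVn sqr_sqrtr// ltW.
rewrite le_eqVlt => /predU1P[|Wx]; first by right.
left; case: (leP (W w) 0) => W0; first by right.
left; apply/negP; rewrite -ltNge.
rewrite -{1}(invrK x) ltf_pV2 ?posrE ?invr_gt0 ?exprn_gt0// -x2 ltr_pXn2r//.
- by rewrite nnegrE ltW.
- by rewrite nnegrE invr_ge0 ltW.
Qed.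

Lemma inverse_square_cdf_le1 x : x <= 1 -> cdf X x = 0%E.
Proof.
have [_ _ M1 _] := W_cdf.
move=> x1; apply/eqP; rewrite -measure_le0 -/(cdf X x).
rewrite (le_trans (cdf_nondecreasing X x1))// inverse_square_cdf//.
by rewrite sqrtr1 invr1 /M M1 subrr.
Qed.

(** Where W > 0, the value r of X determines W as 1 / sqrt r, which is not an atom; the event W <= 0
    is null. *)
Lemma inverse_square_no_atom r : P (X @^-1` [set r]) = 0%E.
Proof.
have mW0 : measurable (W @^-1` `]-oo, 0]) by exact: mpre.
have mWr : measurable (W @^-1` [set (Num.sqrt r)^-1]) by exact: mpre.
apply: (subset_measure0 _ (measurableU _ _ mWr mW0)); first exact: mpre.
  move=> w /= <-; rewrite XW in_itv/= -sqrtrV ?invr_ge0 ?sqr_ge0// invrK sqrtr_sqr.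
  by case: (leP (W w) 0) => W0; [right|left; rewrite gtr0_norm].
exact: etrans (measureU0 mWr mW0 W_le0) (W_atom _).
Qed.

Lemma inverse_square_gt0 : {ae P, forall w, 0 < X w}.
Proof.
exists (W @^-1` `]-oo, 0]); split => //; first exact: mpre.
move=> w /= /negP; rewrite XW invr_gt0 exprn_even_gt0//= negbK in_itv/=.
by move=> /eqP ->.
Qed.

Lemma inverse_square_cdf_lt x y : 1 <= x -> x < y -> (cdf X x < cdf X y)%E.
Proof.
move=> x1 xy; have y1 : 1 <= y by lra.
rewrite !inverse_square_cdf ?lte_fin; try lra.
have /andP[? ?] := invsqrt_itv x1; have /andP[? ?] := invsqrt_itv y1.
have : M (Num.sqrt y)^-1 < M (Num.sqrt x)^-1.
  apply: (semicircular_cdf_lt W_cdf); rewrite ?in_itv/=; try lra.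
  rewrite ltf_pV2 ?posrE ?sqrtr_gt0 ?ltr_sqrt//; lra.
lra.
Qed.

Lemma inverse_square_support : law_support X = `[1, +oo[%classic.
Proof.
apply/seteqP; split => x /=; rewrite in_itv/= andbT.
  move=> Hx; rewrite leNgt; apply/negP => x1.
  have := Hx (1 - x); rewrite subr_gt0 => /(_ x1).
  rewrite (_ : P _ = 0%E) ?ltxx//.
  have mX1 : measurable (X @^-1` `]-oo, 1]) by exact: mpre.
  apply: (subset_measure0 _ mX1); first by apply: mpre; exact: measurable_ball.
    by move=> w /=; rewrite in_itv/= /ball/= ltr_norml; lra.
  exact: inverse_square_cdf_le1.
move=> x1 e e0; rewrite lt0e measure_ge0 andbT; apply/negP => /eqP Pe.
(* A null ball around [x] would leave no mass between [x] and [x + e / 2], against strict growth on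
   [1, +oo). *)
have : (cdf X x < cdf X (x + e / 2))%E by apply: inverse_square_cdf_lt; lra.
apply/negP; rewrite -leNgt.
have mB : measurable (X @^-1` ball x e) by apply: mpre; exact: measurable_ball.
have mC : measurable (X @^-1` `]-oo, x]) by exact: mpre.
rewrite -[cdf X x](measureU0 mC mB Pe) /cdf /distribution /pushforward.
apply: le_measure; rewrite ?inE.
- exact: mpre.
- exact: measurableU.
- move=> w /=; rewrite !in_itv/= /ball/= => Xw.
  case: (leP (X w) x) => Xx; [by left|right].
  by rewrite ltr_norml; lra.
Qed.

(** Since M is strictly increasing on [0, 1], 1 - M s <= 1 - M (1 / sqrt x) means 1 / sqrt x <= s,
    so the infimum is attained at x = 1 / s^2. *)
Lemma inverse_square_cdf_inv s : 0 < s <= 1 ->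
  cdf_inv X (1 - M s)%:E = ((s ^+ 2)^-1)%:E.
Proof.
move=> /andP[s0 s1]; have s2 : 0 < s ^+ 2 by rewrite exprn_gt0.
have s2V : 1 <= (s ^+ 2)^-1 by rewrite invf_ge1// expr_le1// ltW.
rewrite /cdf_inv inverse_square_support; apply/eqP; rewrite eq_le.
apply/andP; split.
  apply: ereal_inf_lbound; exists (s ^+ 2)^-1 => //=.
  rewrite in_itv/= s2V; split => //.
  rewrite inverse_square_cdf ?invr_gt0// sqrtrV ?(ltW s2)//.
  by rewrite invrK sqrtr_sqr gtr0_norm.
apply: le_ereal_inf_tmp => _ [x [/= + +] <-]; rewrite in_itv/= andbT => x1.
rewrite inverse_square_cdf; last by lra.
rewrite !lee_fin lerD2l lerN2 => Mxs.
have /andP[sx0 sx1] := invsqrt_itv x1.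
have sxs : (Num.sqrt x)^-1 <= s.
  rewrite leNgt; apply/negP => ssx; have : M s < M (Num.sqrt x)^-1.
    by apply: (semicircular_cdf_lt W_cdf) => //; rewrite in_itv/=; lra.
  by rewrite ltNge Mxs.
rewrite -[leRHS]invrK lef_pV2 ?posrE ?invr_gt0//; last by lra.
rewrite -(sqr_sqrtr (_ : 0 <= x)); last by lra.
by rewrite -exprVn ler_pXn2r ?nnegrE//; lra.
Qed.

Lemma inverse_square_star_regular : star_regular X.
Proof.
split.
- exact: inverse_square_gt0.
- exact: cdf_no_atom_continuous inverse_square_no_atom.
- by rewrite inverse_square_support; exact: interval_is_interval.
- move=> x y; rewrite inverse_square_support/= in_itv/= andbT => x1 _.
  exact: inverse_square_cdf_lt.
Qed.

End inverse_square.

(** Put t = 1 / sqrt x and let s solve M2 s = M1 t. The quotient in the star order at x is then s^-2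
    / t^-2 = (t / s)^2. As t decreases in x, its monotonicity in x is the monotonicity of s / t in
    t. *)
Lemma inverse_square_star_le (R : realType)
    d1 (T1 : measurableType d1) (P1 : probability T1 R)
    d2 (T2 : measurableType d2) (P2 : probability T2 R)
    (X1 W1 : {RV P1 >-> R}) (X2 W2 : {RV P2 >-> R}) (a1 a2 : R) :
  a1 < a2 ->
  (forall w, X1 w = (W1 w ^+ 2)^-1) -> (forall w, X2 w = (W2 w ^+ 2)^-1) ->
  (forall r : R, P1 (W1 @^-1` [set r]) = 0%E) ->
  (forall r : R, P2 (W2 @^-1` [set r]) = 0%E) ->
  semicircular_cdf a1 (fine \o cdf W1) -> semicircular_cdf a2 (fine \o cdf W2) ->
  star_le X1 X2.
Proof.
move=> a12 XW1 XW2 at1 at2 sc1 sc2; split.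
- exact: inverse_square_star_regular XW1 at1 sc1.
- exact: inverse_square_star_regular XW2 at2 sc2.
set M1 := fine \o _ in sc1; set M2 := fine \o _ in sc2.
have inv_cdf x : 1 <= x -> exists2 s, 0 < s <= 1 & M2 s = M1 (Num.sqrt x)^-1 /\
    cdf_inv X2 (cdf X1 x) = ((s ^+ 2)^-1)%:E.
  move=> x1; have /andP[t0 t1] := invsqrt_itv x1.
  have [_ M10 M11 _] := sc1; have [M2c M20 M21 _] := sc2.
  have Mt0 : M1 0 < M1 (Num.sqrt x)^-1.
    by apply: (semicircular_cdf_lt sc1); rewrite ?in_itv/=; lra.
  have Mt1 : M1 (Num.sqrt x)^-1 <= M1 1.
    move: t1; rewrite le_eqVlt => /predU1P[->//|t1]; apply: ltW.
    by apply: (semicircular_cdf_lt sc1); rewrite ?in_itv/=; lra.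
  (* The solution [s] is not 0, because its image M1 (1 / sqrt x) is strictly larger than 0 = M2
     0. *)
  have [|s + Ms] := @IVT _ M2 0 1 (M1 (Num.sqrt x)^-1) ler01
      (continuous_subspaceT M2c).
    by rewrite M20 M21 min_l ?max_r ?ler01// -M10 -M11 (ltW Mt0).
  rewrite in_itv/= => /andP[s0 s1].
  have s01 : 0 < s <= 1.
    rewrite s1 andbT lt_neqAle s0 andbT; apply: contraTN Mt0 => /eqP s0'.
    by rewrite -Ms -s0' M20 M10 ltxx.
  exists s => //; split => //.
  rewrite (inverse_square_cdf XW1 at1 sc1); last by lra.
  by rewrite -[(fine \o cdf W1) _]Ms (inverse_square_cdf_inv XW2 at2 sc2).
move=> x y; rewrite (inverse_square_support XW1 at1 sc1)/= !in_itv/= !andbT.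
move=> x1 y1 _; rewrite le_eqVlt => /predU1P[->//|xy].
have [s s01 [Ms ->]] := inv_cdf _ x1; have [s' s'01 [Ms' ->]] := inv_cdf _ y1.
have /andP[t0 t1] := invsqrt_itv x1; have /andP[t'0 t'1] := invsqrt_itv y1.
have sqx : 0 < Num.sqrt x by rewrite -invr_gt0.
have sqy : 0 < Num.sqrt y by rewrite -invr_gt0.
have tt' : (Num.sqrt y)^-1 < (Num.sqrt x)^-1.
  by rewrite ltf_pV2// ltr_sqrt//; lra.
(* The pairs are exchanged: the larger point [y] corresponds to the smaller argument 1 / sqrt y. *)
have := semicircular_cdf_ratio a12 sc1 sc2 t'0 tt' t1 s'01 s01 Ms' Ms.
rewrite !invrK -!EFinM lee_fin -!invfM => H.
have /andP[s0 _] := s01; have /andP[s'0 _] := s'01.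
rewrite lef_pV2 ?posrE ?mulr_gt0 ?exprn_gt0//; try lra.
have x0 : 0 <= x by lra.
have y0 : 0 <= y by lra.
rewrite -(sqr_sqrtr x0) -(sqr_sqrtr y0) -!exprMn.
by rewrite ler_pXn2r// nnegrE mulr_ge0// ltW.
Qed.

(** * The law of a ratio of independent variables *)

Section lebesgue_scaling.
Context {R : realType}.
Notation mu := (@lebesgue_measure R).

(** Lebesgue measure is determined by its values on the intervals ]a, b], and the preimage of such
    an interval under multiplication by [c] is ]a / c, b / c]. *)
Lemma lebesgue_measure_scale (c : R) (A : set R) (c0 : 0 < c) : measurable A ->
  mu A = (c%:E * pushforward mu ( *%R c : _ -> measurableTypeR R) A)%E.
Proof.
move=> mA.
have mc : measurable_fun [set: measurableTypeR R]
    ( *%R c : _ -> measurableTypeR R).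
  exact: mulrl_measurable.
pose phi : {mfun measurableTypeR R >-> measurableTypeR R} :=
  HB.pack_for {mfun measurableTypeR R >-> measurableTypeR R}
  ( *%R c : _ -> measurableTypeR R)
  (isMeasurableFun.Build _ _ _ _ _ mc).
apply: (@lebesgue_measure_unique R
  (mscale (NngNum (ltW c0)) (pushforward mu phi))) => //.
move=> _ [[a b]] _ <- /=; rewrite /mscale/= /pushforward.
rewrite (_ : _ @^-1` _ = `]a / c, b / c]%classic); last first.
  apply/seteqP; split => x /=;
  by rewrite !in_itv/= ltr_pdivrMr// ler_pdivlMr// (mulrC c).
rewrite !lebesgue_measure_itv/= !lte_fin ltr_pM2r ?invr_gt0//.
case: ifPn => _; last by rewrite mule0.
by rewrite -!EFinD -EFinM; congr _%:E; field; rewrite gt_eqF.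
Qed.

Lemma ge0_integral_scale (c : R) (f : R -> \bar R) : 0 < c ->
  measurable_fun [set: R] f -> (forall x, 0 <= f x)%E ->
  (\int[mu]_x f x = c%:E * \int[mu]_x f (c * x)%R)%E.
Proof.
move=> c0 mf f0.
have mc : measurable_fun [set: measurableTypeR R]
    ( *%R c : _ -> measurableTypeR R).
  exact: mulrl_measurable.
rewrite -[X in (_ * X)%E](@ge0_integral_pushforward _ _ _ _ _ _ mc mu setT f)//.
rewrite -(@ge0_integral_mscale _ _ _ _ _ _ (NngNum (ltW c0)))//.
by apply: eq_measure_integral => A mA _; exact: lebesgue_measure_scale.
Qed.

End lebesgue_scaling.

Section integral_density.
Context {R : realType}.
Notation mu := (@lebesgue_measure R).

(** The density makes [nu] absolutely continuous, and [f] agrees almost everywhere with the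
    Radon-Nikodym derivative because both have the same integral over every measurable set. *)
Lemma integral_density (nu : probability (measurableTypeR R) R) (f : R -> R)
    (h : R -> \bar R) :
  measurable_fun [set: R] f -> (forall x, 0 <= f x) ->
  (forall A, measurable A -> nu A = (\int[mu]_(x in A) (f x)%:E)%E) ->
  nu.-integrable [set: R] h ->
  (\int[nu]_x h x = \int[mu]_x (h x * (f x)%:E))%E.
Proof.
move=> mf f0 nuf hint.
have dom : nu `<< mu.
  apply/null_content_dominatesP => A mA muA; rewrite nuf//.
  by apply: null_set_integral => //; exact/measurable_funTS/measurable_EFinP.
rewrite -(Radon_Nikodym_change_of_variables dom)//=.
apply: ae_eq_integral => //.
- by apply: emeasurable_funM => //; exact: measurable_int hint.
- apply: emeasurable_funM => //; first exact: measurable_int hint.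
  exact/measurable_EFinP.
- apply: ae_eqe_mul2l => /=.
  rewrite Radon_NikodymE//=.
  case: cid => /= g [g1 g2 g3].
  apply: integral_ae_eq => //=.
  + exact/measurable_EFinP.
  + by move=> E E01 mE; rewrite -g3//= nuf.
Qed.
End integral_density.

Section ratio_law.
Context {R : realType} d (T : measurableType d) (P : probability T R).
Notation mu := (@lebesgue_measure R).
Notation mR := (measurableTypeR R).
Variables (U V : {RV P >-> mR}) (f g : R -> R).
Hypothesis mf : measurable_fun [set: R] f.
Hypothesis mg : measurable_fun [set: R] g.
Hypothesis f0 : forall x, 0 <= f x.
Hypothesis g0 : forall x, 0 <= g x.
Hypothesis gN : forall x, x <= 0 -> g x = 0.
Hypothesis Uf : forall A : set R, measurable A ->
  distribution P U A = (\int[mu]_(x in A) (f x)%:E)%E.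
Hypothesis Vg : forall A : set R, measurable A ->
  distribution P V A = (\int[mu]_(x in A) (g x)%:E)%E.
Hypothesis UV : forall A B : set R, measurable A -> measurable B ->
  P (U @^-1` A `&` V @^-1` B) = (P (U @^-1` A) * P (V @^-1` B))%E.

(** By independence the law of (V, U) agrees with the product of the marginals on rectangles, hence
    everywhere. *)
Lemma joint_law (E : set (mR * mR)) : measurable E ->
  P [set w | E (V w, U w)] =
  (\int[distribution P V]_y distribution P U (xsection E y))%E.
Proof.
move=> mE.
have mVU : measurable_fun [set: T] (fun w => (V w, U w)).
  exact: measurable_fun_pair.
pose VU : {mfun T >-> (mR * mR)%type} :=
  HB.pack_for {mfun T >-> (mR * mR)%type} (fun w => (V w, U w))
  (isMeasurableFun.Build _ _ _ _ _ mVU).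
apply/esym.
apply: (@product_measure_unique _ _ _ _ _ (distribution P V) (distribution P U)
  (distribution P VU)) => //.
move=> A B mA mB; rewrite [RHS]muleC -[RHS]UV// setIC; congr (P _).
Qed.

(** Joint density of V and U / V at p = (y, z): the product density at V = y and U = y z, times the
    Jacobian y. *)
Let K (p : mR * mR) : R := f (p.1 * p.2) * g p.1 * p.1.

Let K0 p : 0 <= K p.
Proof.
rewrite /K; case: (leP p.1 0) => p1; first by rewrite gN// mulr0 mul0r.
by rewrite !mulr_ge0// ltW.
Qed.

Let mK : measurable_fun [set: mR * mR] K.
Proof.
apply: measurable_funM => //; apply: measurable_funM => //.
  by apply: measurableT_comp => //; exact: measurable_funM.
exact: measurableT_comp.
Qed.

Lemma ratio_law (A : set R) : measurable A ->
  P [set w | A (U w / V w)] = (\int[mu]_(z in A) \int[mu]_y (K (y, z))%:E)%E.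
Proof.
move=> mA.
pose E := [set p : mR * mR | A (p.2 / p.1)].
have mE : measurable E.
  rewrite -[E]setTI;
    apply: (_ : measurable_fun setT (fun p : mR * mR => p.2 / p.1)) => //.
  apply: measurable_funM => //.
  by apply: (measurableT_comp (@measurable_inv_real R)).
rewrite (joint_law mE).
have PU1 y : (distribution P U (xsection E y) <= 1)%E.
  by apply: probability_le1; exact: measurable_xsection.
rewrite (@integral_density R (distribution P V) g)//; last first.
  have mh : measurable_fun [set: mR] (fun y => distribution P U (xsection E y)).
    exact: measurable_fun_xsection.
  apply: (@le_integrable _ _ _ (distribution P V) _ measurableT _
    (cst 1%E)) => //.
    by move=> y _; rewrite gee0_abs// gee0_abs.
  by apply: finite_measure_integrable_cst.
(* For y > 0 the inner integral is rescaled by u = y z, which turns the section of [E] into [A]; for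
   y <= 0 both sides vanish with [g y]. *)
transitivity (\int[mu]_y \int[mu]_z (K (y, z) * \1_A z)%:E)%E.
  apply: eq_integral => y _.
  case: (leP y 0) => y0.
    rewrite gN// mule0 integral0_eq// => z _.
    by rewrite /K/= gN// mulr0 !mul0r.
  have mEy : measurable (xsection E y) by exact: measurable_xsection.
  have mF : measurable_fun [set: mR]
      (fun x => (f x)%:E * (EFin \o \1_(xsection E y)) x)%E.
    apply: emeasurable_funM; first exact/measurable_EFinP.
    by apply/measurable_EFinP; exact: measurable_indic.
  rewrite Uf// integral_mkcond/= epatch_indic.
  rewrite (ge0_integral_scale y0 mF); last first.
    by move=> x; rewrite mule_ge0 ?lee_fin.
  rewrite muleAC -ge0_integralZl//.
  - apply: eq_integral => z _ /=; rewrite -!EFinM; congr _%:E.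
    rewrite (_ : \1_(xsection E y) (y * z) = \1_A z :> R).
      by rewrite /K/=; ring.
    rewrite !indicE; congr (nat_of_bool _)%:R.
    by apply/idP/idP; rewrite !inE /xsection/= inE /E/= mulrAC divff ?mul1r ?gt_eqF//.
  - by apply: (measurableT_comp mF); exact: mulrl_measurable.
  - by move=> x _; rewrite mule_ge0 ?lee_fin.
  - by rewrite -EFinM lee_fin mulr_ge0// ltW.
rewrite (@fubini_tonelli _ _ _ _ _ mu mu (fun p => (K p * \1_A p.2)%:E)); last 2 first.
- apply/measurable_EFinP; apply: measurable_funM => //.
  by apply: measurableT_comp => //; exact: measurable_indic.
- by move=> p; rewrite lee_fin mulr_ge0.
rewrite [RHS]integral_mkcond/= epatch_indic; apply: eq_integral => z _.
under eq_integral do rewrite EFinM.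
rewrite ge0_integralZr//.
- apply/measurable_EFinP; apply: (measurableT_comp mK).
  exact: measurable_fun_pair.
- by move=> y _; rewrite lee_fin.
Qed.

End ratio_law.

(** * The ratio of two gamma variables *)

Section gamma_ratio.
Context {R : realType}.
Notation mu := (@lebesgue_measure R).

Lemma measurable_fun_if_gt0 (f : R -> R) : measurable_fun [set: R] f ->
  measurable_fun [set: R] (fun x => if 0 < x then f x else 0).
Proof. by move=> mf; apply: measurable_fun_ifT => //; exact: measurable_fun_ltr. Qed.

Lemma measurable_gamma_pdf (a l : R) : measurable_fun [set: R] (gamma_pdf a l).
Proof.
apply: measurable_fun_if_gt0; apply: measurable_funM.
  by apply: measurable_funM => //; exact: measurable_powR.
apply: measurableT_comp; first exact: measurable_expR.
by apply: measurable_funM => //; exact: measurable_funN.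
Qed.

Lemma gamma_pdf_ge0 (a l x : R) : 0 <= gamma_pdf a l x.
Proof.
rewrite /gamma_pdf; case: ifPn => // x0.
rewrite !mulr_ge0 ?powR_ge0 ?expR_ge0// invr_ge0 mulr_ge0 ?powR_ge0//.
by apply: Rintegral_ge0 => y _; rewrite mulr_ge0 ?powR_ge0 ?expR_ge0.
Qed.

(* Density, up to a constant factor, of the ratio of two independent variables
   with a gamma law of shape [a]. *)
Definition beta_prime_kernel (a z : R) : R :=
  if 0 < z then z `^ (a - 1) * (1 + z) `^ (- (2 * a)) else 0.

Lemma measurable_beta_prime_kernel (a : R) :
  measurable_fun [set: R] (beta_prime_kernel a).
Proof.
apply: measurable_fun_if_gt0; apply: measurable_funM; first exact: measurable_powR.
apply: (@measurableT_comp _ _ _ _ _ _ (@powR R ^~ (- (2 * a)))).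
  exact: measurable_powR.
exact: measurable_funD.
Qed.

Lemma beta_prime_kernel_ge0 (a z : R) : 0 <= beta_prime_kernel a z.
Proof. by rewrite /beta_prime_kernel; case: ifPn => // _; rewrite mulr_ge0 ?powR_ge0. Qed.

(** The gamma density without its normalising constant. It is used with shape 2a, that of the sum of
    two independent gamma variables of shape a. *)
Definition gamma_kernel (a l v : R) : R :=
  if 0 < v then v `^ (a - 1) * expR (- v / l) else 0.

Lemma measurable_gamma_kernel (a l : R) :
  measurable_fun [set: R] (gamma_kernel a l).
Proof.
apply: measurable_fun_if_gt0; apply: measurable_funM; first exact: measurable_powR.
apply: measurableT_comp; first exact: measurable_expR.
by apply: measurable_funM => //; exact: measurable_funN.
Qed.

Lemma gamma_kernel_ge0 (a l v : R) : 0 <= gamma_kernel a l v.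
Proof.
rewrite /gamma_kernel; case: ifPn => // _.
by rewrite mulr_ge0 ?powR_ge0 ?expR_ge0.
Qed.

Lemma integral_gamma_pdf_ratio (a l z : R) (K := (gamma_fun a * l `^ a)^-1) :
  (\int[mu]_y (gamma_pdf a l (y * z) * gamma_pdf a l y * y)%:E =
   (K ^+ 2)%:E *
   (\int[mu]_v (gamma_kernel (2 * a) l v)%:E) *
   (beta_prime_kernel a z)%:E)%E.
Proof.
rewrite /beta_prime_kernel; case: ifPn => [z0|]; last first.
  rewrite -leNgt => z0; rewrite mule0 integral0_eq// => y _.
  rewrite /gamma_pdf; case: ifPn => [yz0|_]; last by rewrite !mul0r.
  case: ifPn => [y0|_]; last by rewrite mulr0 mul0r.
  by move: yz0; rewrite ltNge mulr_ge0_le0// ltW.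
have me : measurable_fun [set: R] (EFin \o gamma_kernel (2 * a) l).
  by apply/measurable_EFinP; exact: measurable_gamma_kernel.
have z1 : 0 < 1 + z by lra.
rewrite (ge0_integral_scale z1 me); last first.
  by move=> v; rewrite lee_fin gamma_kernel_ge0.
(* The substitution v = (1 + z) y merges the two exponentials and separates v from z. The power of 1
   + z in [c] comes from v^(2a - 1); one more factor 1 / (1 + z) is the Jacobian. *)
set c := K ^+ 2 * (z `^ (a - 1) * (1 + z) `^ (- (2 * a - 1))).
transitivity (\int[mu]_y (c%:E * (gamma_kernel (2 * a) l ((1 + z) * y))%:E))%E.
  apply: eq_integral => y _; rewrite -EFinM; congr _%:E.
  rewrite /gamma_pdf /gamma_kernel (pmulr_rgt0 _ z1) (pmulr_lgt0 _ z0).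
  case: ifPn => y0; last by rewrite !mul0r mulr0.
  rewrite /c (powRM _ (ltW y0) (ltW z0)) (powRM _ (ltW z1) (ltW y0)) powRN.
  have -> : - ((1 + z) * y) / l = - (y * z) / l + - y / l by lra.
  have -> : y `^ (2 * a - 1) = y `^ (a - 1) * y `^ (a - 1) * y.
    rewrite -[X in _ = _ * X](powRr1 (ltW y0)) -!powRD ?(gt_eqF y0) ?implybT//.
    by congr powR; ring.
  rewrite expRD -/K; field.
  by rewrite gt_eqF// powR_gt0.
rewrite ge0_integralZl//.
- have -> : (1 + z) `^ (- (2 * a)) = (1 + z) `^ (- (2 * a - 1)) * (1 + z)^-1.
    rewrite -(powR_inv1 (ltW z1)) -powRD ?(gt_eqF z1) ?implybT//.
    by congr powR; ring.
  rewrite muleA [RHS]muleAC -!EFinM; congr (_%:E * _)%E.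
  by rewrite /c; field; rewrite gt_eqF.
- by apply: (measurableT_comp me); exact: mulrl_measurable.
- by move=> y _; rewrite lee_fin gamma_kernel_ge0.
- by rewrite lee_fin /c mulr_ge0 ?sqr_ge0// mulr_ge0 ?powR_ge0.
Qed.

Lemma gamma_ratio_law d (T : measurableType d) (P : probability T R)
    (U V : {RV P >-> R}) (a l : R) :
  has_gamma_law U a l -> has_gamma_law V a l ->
  (forall A B : set R, measurable A -> measurable B ->
    P (U @^-1` A `&` V @^-1` B) = (P (U @^-1` A) * P (V @^-1` B))%E) ->
  exists2 C : R, 0 < C & forall A : set R, measurable A ->
    P [set w | A (U w / V w)] =
    (\int[mu]_(z in A) (C * beta_prime_kernel a z)%:E)%E.
Proof.
move=> Ua Va UV.
have mRV (Y : {RV P >-> R}) : measurable_fun [set: T] (Y : T -> measurableTypeR R).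
  by move=> mT A mA; exact: measurable_funP.
pose pack (Y : {RV P >-> R}) : {RV P >-> measurableTypeR R} :=
  HB.pack_for {mfun T >-> measurableTypeR R} (Y : T -> measurableTypeR R)
  (isMeasurableFun.Build _ _ _ _ _ (mRV Y)).
have law A mA := @ratio_law R d T P (pack U) (pack V) _ _
  (measurable_gamma_pdf a l) (measurable_gamma_pdf a l)
  (gamma_pdf_ge0 a l) (gamma_pdf_ge0 a l) _ Ua Va UV A mA.
set K := (gamma_fun a * l `^ a)^-1.
set E := (\int[mu]_v (gamma_kernel (2 * a) l v)%:E)%E.
have E0 : (0 <= E)%E.
  by apply: integral_ge0 => v _; rewrite lee_fin gamma_kernel_ge0.
pose C := ((K ^+ 2)%:E * E)%E.
have C0 : (0 <= C)%E by rewrite mule_ge0// lee_fin sqr_ge0.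
have mk (A : set R) : measurable_fun (A : set (measurableTypeR R))
    (EFin \o beta_prime_kernel a).
  apply: measurable_funTS; apply/measurable_EFinP.
  exact: measurable_beta_prime_kernel.
have lawC A : measurable A ->
    P [set w | A (U w / V w)] =
    (C * \int[mu]_(z in A) (beta_prime_kernel a z)%:E)%E.
  move=> mA; rewrite law//; last first.
    by move=> x x0; rewrite /gamma_pdf ltNge x0.
  under eq_integral do rewrite /= integral_gamma_pdf_ratio.
  rewrite ge0_integralZl//.
  - by move=> z _; rewrite lee_fin beta_prime_kernel_ge0.
(* The constant is not evaluated. Total mass 1 shows that it is positive and finite: 0 would give
   mass 0, and +oo would give mass 0 or +oo. *)
have := lawC setT measurableT.
rewrite (_ : [set w | _] = setT)// probability_setT => C1.
have : exists2 c, C = c%:E & 0 < c.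
  move: C0 C1; move: (C) => -[c||]//.
  - rewrite lee_fin le_eqVlt => /predU1P[<-|c0 _]; last by exists c.
    by rewrite mul0e => /eqP; rewrite eqe oner_eq0.
  - move=> _; set I := (X in (+oo * X)%E).
    have : (0 <= I)%E.
      by apply: integral_ge0 => z _; rewrite lee_fin beta_prime_kernel_ge0.
    rewrite le_eqVlt => /predU1P[<-|I0].
      by rewrite mule0 => /eqP; rewrite eqe oner_eq0.
    by rewrite gt0_mulye.
move=> [c Cc c0]; exists c => // A mA; rewrite lawC// Cc.
under [RHS]eq_integral do rewrite EFinM.
rewrite ge0_integralZl//.
- by move=> z _; rewrite lee_fin beta_prime_kernel_ge0.
- by rewrite lee_fin ltW.
Qed.

End gamma_ratio.

(** * The normalized distance |U - V| / (U + V) *)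

Lemma measure_eq_mod_null d (T : measurableType d) (R : realType)
    (P : {measure set T -> \bar R}) (A B N : set T) :
  measurable A -> measurable B -> measurable N -> P N = 0%E ->
  (forall w, ~ N w -> A w <-> B w) -> P A = P B.
Proof.
move=> mA mB mN N0 AB; rewrite -(measureU0 mA mN N0) -(measureU0 mB mN N0).
congr (P _); apply/seteqP; split => w [H|?]; try by right.
- by have [|/AB[h _]] := pselect (N w); [right|left; exact: h].
- by have [|/AB[_ h]] := pselect (N w); [right|left; exact: h].
Qed.

(** The two solutions belong to the two signs of u - v and are reciprocal. A vanishing denominator
    would force v = 0. *)
Lemma ratio_of_normalized_distance (R : realType) (u v t : R) : 0 < u -> 0 < v ->
  `|u - v| / (u + v) = t ->
  u / v = (1 + t) / (1 - t) \/ u / v = (1 - t) / (1 + t).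
Proof.
move=> u0 v0 Wt.
have H : `|u - v| = t * (u + v) by rewrite -Wt divfK// gt_eqF// addr_gt0.
have [uv|uv] := leP 0 (u - v).
- left; rewrite ger0_norm// in H.
  have t1 : 1 - t != 0.
    apply/eqP => t1; have tE : t = 1 by lra.
    by move: H; rewrite tE => H; have vE : v = 0; [lra|rewrite vE ltxx in v0].
  by apply/eqP; rewrite eqr_div// ?(gt_eqF v0)//; apply/eqP; lra.
- right; rewrite ltr0_norm// in H.
  have t1 : 1 + t != 0.
    apply/eqP => t1; have tE : t = -1 by lra.
    by move: H; rewrite tE => H; have vE : v = 0; [lra|rewrite vE ltxx in v0].
  by apply/eqP; rewrite eqr_div// ?(gt_eqF v0)//; apply/eqP; lra.
Qed.

Section ratio_to_semicircular.
Context {R : realType} d (T : measurableType d) (P : probability T R).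
Notation mu := (@lebesgue_measure R).
Variables (U V W : {RV P >-> R}) (a C : R).
Hypothesis C0 : 0 < C.
Hypothesis U0 : P (U @^-1` `]-oo, 0]) = 0%E.
Hypothesis V0 : P (V @^-1` `]-oo, 0]) = 0%E.
Hypothesis WE : forall w, W w = `|U w - V w| / (U w + V w).
Let k z := C * beta_prime_kernel a z.
Hypothesis law : forall A : set R, measurable A ->
  P [set w | A (U w / V w)] = (\int[mu]_(z in A) (k z)%:E)%E.

Let mpre (Y : {RV P >-> R}) (A : set R) : measurable A -> measurable (Y @^-1` A).
Proof. by move=> mA; exact: measurable_funPTI. Qed.

Let mratio (A : set R) : measurable A -> measurable [set w | A (U w / V w)].
Proof.
move=> mA.
have mZ : measurable_fun [set: T] (fun w => U w / V w).
  by apply: measurable_funM => //; exact: measurableT_comp (@measurable_inv_real R) _.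
by rewrite -[X in measurable X]setTI; exact: mZ.
Qed.

Let N := U @^-1` `]-oo, 0] `|` V @^-1` `]-oo, 0].

Let mN : measurable N.
Proof. by apply: measurableU; exact: mpre. Qed.

Let PN : P N = 0%E.
Proof. exact: etrans (measureU0 (mpre _ _) (mpre _ _) V0) U0. Qed.

Let notN w : ~ N w -> 0 < U w /\ 0 < V w.
Proof.
by rewrite /N/= !in_itv/= => /not_orP[/negP + /negP]; rewrite -!ltNge.
Qed.

Let ratio_atom r : P [set w | U w / V w = r] = 0%E.
Proof.
rewrite (law (measurable_set1 r)); apply: null_set_integral => //.
- apply: measurable_funTS; apply/measurable_EFinP; apply: measurable_funM => //.
  exact: measurable_beta_prime_kernel.
- exact: lebesgue_measure_set1.
Qed.

(** Off the null event [N], a level set of W is contained in two level sets of the ratio U / V, both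
    null because the ratio has a density. *)
Lemma normalized_distance_no_atom t : P (W @^-1` [set t]) = 0%E.
Proof.
pose A r := [set w | U w / V w = r].
have mA r : measurable (A r) by exact: mratio (measurable_set1 r).
have mAA : measurable (A ((1 + t) / (1 - t)) `|` A ((1 - t) / (1 + t))).
  exact: measurableU.
apply: (subset_measure0 _ (measurableU _ _ mAA mN)); first exact: mpre.
  move=> w /= Wt; have [Nw|/notN[u0 v0]] := pselect (N w); first by right.
  by left; apply: ratio_of_normalized_distance => //; rewrite -WE.
have PA := measureU0
  (mA ((1 + t) / (1 - t))) (mA ((1 - t) / (1 + t))) (ratio_atom _).
exact: etrans (measureU0 mAA mN PN) (etrans PA (ratio_atom _)).
Qed.

Let G q := (\int[mu]_(z in `]-oo, q]) k z)%R.

Let mk (A : set R) : measurable_fun (A : set (measurableTypeR R)) (EFin \o k).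
Proof.
apply: measurable_funTS; apply/measurable_EFinP; apply: measurable_funM => //.
exact: measurable_beta_prime_kernel.
Qed.

Let k0 z : 0 <= k z.
Proof. by rewrite mulr_ge0 ?beta_prime_kernel_ge0// ltW. Qed.

Let kint (A : set R) : measurable A -> mu.-integrable A (EFin \o k).
Proof.
move=> mA; apply/integrableP; split; first exact: mk.
under eq_integral do rewrite /= ger0_norm//.
by rewrite -law//; apply: (le_lt_trans (probability_le1 P (mratio mA))); exact: ltry.
Qed.

Let GE q : P [set w | U w / V w <= q] = (G q)%:E.
Proof.
rewrite /G /Rintegral fineK; last by apply: integrable_fin_num => //; exact: kint.
by rewrite -law//; congr (P _); apply/seteqP; split => w /=; rewrite in_itv.
Qed.

Let kE z : 0 < z -> k z = C * (z `^ (a - 1) * (1 + z) `^ (- (2 * a))).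
Proof. by move=> z0; rewrite /k /beta_prime_kernel z0. Qed.

Let dG (q : R) : 0 < q -> is_derive q 1 G (k q).
Proof.
move=> q0.
(* [h] is [k] without the case distinction. The two agree near q > 0, so [k] is continuous at q and
   the fundamental theorem of calculus applies there. *)
pose h z := C * (z `^ (a - 1) * (1 + z) `^ (- (2 * a))).
have q10 : 0 < 1 + q by lra.
have d1 : is_derive q 1 (fun z : R => 1 + z) 1 by apply: is_derive_eq; ring.
have d2 := @is_derive1_comp R _ (fun z : R => 1 + z) _ _ _
  (is_derive1_powR (- (2 * a)) q10) d1.
have dh := is_deriveZ C (is_deriveM (is_derive1_powR (a - 1) q0) d2).
have hc : {for q, continuous h}.
  by apply: differentiable_continuous; apply/derivable1_diffP; case: dh.
have kc : {for q, continuous k}.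
  suff : k z @[z --> q] --> h q by rewrite /h -kE.
  apply: cvg_trans hc; apply: near_eq_cvg.
  by near=> z; rewrite kE//; near: z; exact: lt_nbhsr.
have q1 : q < q + 1 by rewrite ltrDl.
have [|Gd Gk] := @continuous_FTC1 R k -oo%O q (q + 1) q1
    (kint (measurable_itv _)) _ kc.
  by rewrite ltNyr.
by apply: DeriveDef => //; rewrite -derive1E.
Unshelve. all: by end_near. Qed.

(** The value of u / v at which (u - v) / (u + v) = t. Thus [J] below is, on ]-1, 1[, the
    distribution function of the signed quantity (U - V) / (U + V). *)
Let q (t : R) : R := (1 + t) / (1 - t).
Let J t := G (q t).

(** In the chain rule 1 + q = 2 / (1 - t) and q' = 2 / (1 - t)^2, so the exponents of 1 - t add up
    to -(a - 1) + 2a - 2 = a - 1, the exponent of 1 + t. *)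
Let dJ (t : R) : -1 < t < 1 ->
  is_derive t 1 J (C * 2 `^ (1 - 2 * a) * (1 - t ^+ 2) `^ (a - 1)).
Proof.
move=> /andP[t0 t1].
have p1 : 0 < 1 - t by lra.
have p2 : 0 < 1 + t by lra.
have q0 : 0 < q t by rewrite divr_gt0.
have dq : is_derive t 1 q (2 / (1 - t) ^+ 2).
  have d1 : is_derive t 1 (fun z : R => 1 + z) 1 by apply: is_derive_eq; ring.
  have d2 : is_derive t 1 (fun z : R => 1 - z) (-1) by apply: is_derive_eq; ring.
  have d3 := is_deriveM d1
    (@is_deriveV R (fun z : R => 1 - z) _ _ _ (lt0r_neq0 p1) d2).
  by apply: is_derive_eq d3 _; rewrite /GRing.scale/=; field; rewrite gt_eqF.
have := @is_derive1_comp R G q t _ _ (dG q0) dq.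
congr is_derive.
rewrite kE//.
have -> : 1 + q t = 2 / (1 - t) by rewrite /q; field; rewrite gt_eqF.
have -> : 1 - t ^+ 2 = (1 + t) * (1 - t) by ring.
have iE p : (1 - t)^-1 `^ p = (1 - t) `^ (- p).
  by rewrite -(powR_inv1 (ltW p1)) -powRrM mulN1r.
have i0 : 0 <= (1 - t)^-1 by rewrite invr_ge0 ltW.
rewrite (powRM _ (ltW p2) (ltW p1)) /q (powRM _ (ltW p2) i0) (powRM _ (ler0n _ 2) i0).
rewrite !iE opprK (powRN _ (a - 1)).
have -> : (1 - t) `^ (2 * a) =
    (1 - t) `^ (a - 1) * (1 - t) `^ (a - 1) * (1 - t) ^+ 2.
  rewrite -(powR_mulrn 2 (ltW p1)) -!powRD ?(gt_eqF p1) ?implybT//.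
  by congr powR; ring.
have -> : 2 `^ (1 - 2 * a) = 2 * 2 `^ (- (2 * a)).
  by rewrite powRD ?pnatr_eq0 ?implybT// powRr1.
by field; rewrite !gt_eqF// powR_gt0.
Qed.

Let W_itv (t : R) : 0 < t < 1 -> fine (cdf W t) = J t - J (- t).
Proof.
move=> /andP[t0 t1].
have p1 : 0 < 1 - t by lra.
have p2 : 0 < 1 + t by lra.
have qq : q (- t) < q t.
  by rewrite /q opprK ltr_pdivrMr// mulrAC ltr_pdivlMr//; nra.
(* For positive U and V, W <= t means that U / V lies in [q (-t), q t]. The left endpoint is
   dropped, at the cost of a null event, so that [A] and [B] partition U / V <= q t. *)
pose A := [set w | U w / V w \in `]q (- t), q t] ].
have mA : measurable A by exact: (@mratio `]q (- t), q t]%classic (measurable_itv _)).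
pose B := [set w | U w / V w <= q (- t)].
have mB : measurable B.
  rewrite (_ : B = [set w | `]-oo, q (- t)]%classic (U w / V w)]).
    exact: mratio.
  by apply/seteqP; split => w; rewrite /B/= in_itv.
have WA : P (W @^-1` `]-oo, t]) = P A.
  have mq : measurable [set w | U w / V w = q (- t)].
    exact: (@mratio [set q (- t)] (measurable_set1 _)).
  apply: (measure_eq_mod_null _ mA (measurableU _ _ mN mq)); first exact: mpre.
    exact: etrans (measureU0 mN mq (ratio_atom _)) PN.
  move=> w /= /not_orP[/notN[u0 v0] /eqP wq].
  rewrite /A/= !in_itv/= WE ler_pdivrMr ?addr_gt0// ler_norml.
  rewrite [q (- t) < _]lt_neqAle eq_sym wq/= /q opprK.
  rewrite (ler_pdivlMr _ _ v0) (ler_pdivrMr _ _ v0) mulrAC ler_pdivrMr//.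
  rewrite [in X in _ <-> X]mulrAC ler_pdivlMr//.
  split => /andP[h1 h2]; apply/andP; split; lra.
have AB : P [set w | U w / V w <= q t] = (P A + P B)%E.
  rewrite -measureU//; last first.
    apply/seteqP; split => w //=; rewrite /A /B/= in_itv/= => -[/andP[+ _]].
    by rewrite ltNge => /negP.
  congr (P _); apply/seteqP; split => w; rewrite /A /B/= in_itv/=.
    by move=> ->; rewrite andbT; case: (leP (U w / V w) (q (- t))); [right|left].
  by move=> [/andP[_ //]|/le_trans]; apply; exact: ltW.
rewrite /cdf /distribution /pushforward WA.
have PBE : P B = (J (- t))%:E by exact: GE.
have := AB; rewrite PBE GE => /(congr1 (fun x => x - (J (- t))%:E)%E).
by rewrite addeK// -EFinB => <-.
Qed.

Lemma normalized_distance_semicircular : semicircular_cdf a (fine \o cdf W).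
Proof.
split.
- move=> x; apply: fine_cvg; rewrite fineK ?fin_num_measure//.
  exact: (cdf_no_atom_continuous normalized_distance_no_atom).
- suff : cdf W 0 = 0%E by move=> /= ->.
  have m0 : measurable (W @^-1` [set 0]) by exact: mpre.
  apply: etrans (normalized_distance_no_atom 0); apply: (measure_eq_mod_null _ m0 mN PN).
    exact: mpre.
  move=> w /notN[u0 v0]; rewrite /= in_itv/= WE.
  split => [h|->//]; apply/eqP; rewrite eq_le h divr_ge0//.
  by rewrite addr_ge0 ?ltW.
- suff : cdf W 1 = 1%E by move=> /= ->.
  rewrite -(probability_setT P).
  apply: (measure_eq_mod_null _ measurableT mN PN); first exact: mpre.
  move=> w /notN[u0 v0]; rewrite /= in_itv/= WE; split => // _.
  by rewrite ler_pdivrMr ?addr_gt0// mul1r ler_norml; apply/andP; split; lra.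
(* The derivative of [J] is even, so both terms of J t - J (-t) contribute equally; this is the last
   factor 2. *)
exists (C * 2 `^ (1 - 2 * a) * 2).
  by rewrite !mulr_gt0// powR_gt0.
move=> t /andP[t0 t1].
have d1 : is_derive t 1 J (C * 2 `^ (1 - 2 * a) * (1 - t ^+ 2) `^ (a - 1)).
  by apply: dJ; lra.
have d2 : is_derive t 1 (J \o -%R)
    (C * 2 `^ (1 - 2 * a) * (1 - t ^+ 2) `^ (a - 1) * -1).
  apply: is_derive1_comp; rewrite -[t ^+ 2]sqrrN.
  by apply: dJ; lra.
have := is_deriveB d1 d2.
set D := (D in is_derive _ _ _ D); set D' := (D in _ -> is_derive _ _ _ D).
have -> : D = D' by rewrite /D /D'; ring.
apply: near_eq_is_derive; near=> x; rewrite /= W_itv//.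
by apply/andP; split; near: x; [exact: lt_nbhsr|exact: lt_nbhsl].
Unshelve. all: by end_near. Qed.

End ratio_to_semicircular.

(** * Moment estimator for samples of size two *)

(** For two observations the mean is (u + v) / 2 and the biased variance (u - v)^2 / 4. With inverse
    of 0 equal to 0, the identity also covers u = v and u + v = 0, where both sides are 0. *)
Lemma sample2_moment_shape (R : realType) d (T : measurableType d)
    (P : probability T R) (X : 'I_2 -> {RV P >-> R}) w :
  moment_shape X w =
  ((`|X ord0 w - X ord_max w| / (X ord0 w + X ord_max w)) ^+ 2)^-1.
Proof.
rewrite /moment_shape /sample_var /sample_mean !big_ord_recl !big_ord0 !addr0.
have -> : lift ord0 ord0 = ord_max :> 'I_2 by exact: val_inj.
move: (X ord0 w) (X ord_max w) => u v.
rewrite [X in _ / X](_ : _ = 2^-1 ^+ 2 * (u - v) ^+ 2); last by field.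
rewrite expr_div_n real_normK ?num_real// invf_div exprMn invfM mulrACA divff ?mul1r//.
Qed.

Lemma independent_RVs2 (R : realType) d (T : measurableType d)
    (P : probability T R) (X : 'I_2 -> {RV P >-> R}) :
  independent_RVs X -> forall A B : set R, measurable A -> measurable B ->
  P (X ord0 @^-1` A `&` X ord_max @^-1` B)
  = (P (X ord0 @^-1` A) * P (X ord_max @^-1` B))%E.
Proof.
move=> ind A B mA mB.
have := ind (fun i => if i == ord0 then A else B).
rewrite !big_ord_recl big_ord0 mule1/=.
have -> : lift ord0 ord0 = ord_max :> 'I_2 by exact: val_inj.
move=> <-; last by move=> i; case: ifP.
congr (P _); apply/seteqP; split => w /=.
  move=> [h1 h2] i _; case: eqP => [->//|i0]; suff -> : i = ord_max by [].
  by apply: val_inj; case: i i0 => -[|[|//]] //= ? i0; case: i0; exact: val_inj.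
by move=> h; split; [exact: (h ord0)|exact: (h ord_max)].
Qed.

Lemma gamma_law_le0 (R : realType) d (T : measurableType d)
    (P : probability T R) (X : {RV P >-> R}) (a l : R) :
  has_gamma_law X a l -> P (X @^-1` `]-oo, 0]) = 0%E.
Proof.
move=> /(_ `]-oo, 0]%classic (measurable_itv _)); rewrite /distribution /pushforward => ->.
apply: integral0_eq => x /=; rewrite in_itv/= => x0.
by rewrite /gamma_pdf ltNge x0.
Qed.

(** The witness is |U - V| / (U + V). It is a function of U / V where both variables are positive,
    so the common scale cancels and its law depends on the shape alone. *)
Lemma gamma_sample_semicircular (R : realType) d (T : measurableType d)
    (P : probability T R) (X : 'I_2 -> {RV P >-> R}) (a l : R) :
  gamma_sample X a l -> exists W : {RV P >-> R},
  [/\ forall w, moment_shape_RV X w = (W w ^+ 2)^-1,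
      forall r : R, P (W @^-1` [set r]) = 0%E &
      semicircular_cdf a (fine \o cdf W)].
Proof.
move=> [[ind _] laws]; pose U := X ord0; pose V := X ord_max.
have mW : measurable_fun [set: T] (fun w => `|U w - V w| / (U w + V w)).
  apply: measurable_funM.
    by apply: measurableT_comp => //; exact: measurable_funB.
  by apply: measurableT_comp (@measurable_inv_real R) _; exact: measurable_funD.
pose W : {RV P >-> R} := HB.pack_for {mfun T >-> R}
  (fun w => `|U w - V w| / (U w + V w)) (isMeasurableFun.Build _ _ _ _ _ mW).
have [C C0 law] := gamma_ratio_law (laws ord0) (laws ord_max) (independent_RVs2 ind).
have U0 := gamma_law_le0 (laws ord0); have V0 := gamma_law_le0 (laws ord_max).
exists W; split.
- exact: sample2_moment_shape.
- exact: (normalized_distance_no_atom U0 V0 (W := W) _ law).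
- exact: (normalized_distance_semicircular C0 U0 V0 (W := W) _ law).
Qed.

Theorem proposition3 (R : realType)
  (d1 d2 : measure_display)
  (T1 : measurableType d1) (T2 : measurableType d2)
  (P1 : probability T1 R) (P2 : probability T2 R)
  (alpha1 alpha2 lambda1 lambda2 : R)
  (X1 : 'I_2 -> {RV P1 >-> R}) (X2 : 'I_2 -> {RV P2 >-> R}) :
  0 < alpha1 -> alpha1 < alpha2 -> 0 < lambda1 -> 0 < lambda2 ->
  gamma_sample X1 alpha1 lambda1 ->
  gamma_sample X2 alpha2 lambda2 ->
  star_le (moment_shape_RV X1) (moment_shape_RV X2).
Proof.
move=> _ a12 _ _ /gamma_sample_semicircular[W1 [XW1 at1 sc1]].
move=> /gamma_sample_semicircular[W2 [XW2 at2 sc2]].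
exact: inverse_square_star_le a12 XW1 XW2 at1 at2 sc1 sc2.
Qed.
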